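(* The multiplicative semigroup $\mathbb{N}$ of positive integers acts by (ring) endomorphisms of the Habiro ring $\widehat{\mathbb{Z}[q]}$ by $$\sigma_n(f)(q)=f(q^n),\qquad n\in\mathbb{N},\ f\in\widehat{\mathbb{Z}[q]}.$$
   Context: The Habiro ring is the inverse limit $\widehat{\mathbb{Z}[q]}=\varprojlim_n\mathbb{Z}[q]/((q)_n)$, where $(q)_n=(1-q)(1-q^2)\cdots(1-q^n)$ and the maps are the natural projections $\mathbb{Z}[q]/((q)_n)\to\mathbb{Z}[q]/((q)_k)$ for $k\le n$. The endomorphism $\sigma_n$ of $\widehat{\mathbb{Z}[q]}$ is the one induced by the endomorphism $f(q)\mapsto f(q^n)$ of $\mathbb{Z}[q]$. *)

(* Defs.v *)
From HB Require Import structures.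
From mathcomp Require Import all_boot all_order all_algebra.
From mathcomp Require Import boolp.

Set Implicit Arguments.
Unset Strict Implicit.
Unset Printing Implicit Defensive.
Import GRing.Theory.
Local Open Scope ring_scope.
Local Open Scope quotient_scope.

Definition qpoch (n : nat) : {poly int} := \prod_(1 <= i < n.+1) (1 - 'X^i).

(* {ideal_quot _} requires a proper ideal and (q)_0 = 1, so the inverse system
   is indexed by n.+1: index n stands for Z[q]/((q)_{n+1}). The index 0 would
   only add the zero ring, which does not change the limit. *)
Definition qpoch_ideal (n : nat) (f : {poly int}) : bool :=
  `[< exists g : {poly int}, f = g * qpoch n.+1 >].

Lemma qpochSE n : qpoch n.+1 = qpoch n * (1 - 'X^(n.+1)).
Proof. by rewrite /qpoch big_nat_recr. Qed.

Lemma qpoch_root n : (qpoch n.+1).[1] = 0.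
Proof. by rewrite qpochSE !hornerE expr1n subrr mulr0. Qed.

Lemma qpoch_idealr_closed n : idealr_closed (qpoch_ideal n).
Proof.
split.
- by apply/asboolP; exists 0; rewrite mul0r.
- apply/asboolP => -[g /(congr1 (horner^~ 1))] /eqP.
  by rewrite /= hornerM qpoch_root mulr0 hornerE oner_eq0.
- move=> a _ _ /asboolP[g ->] /asboolP[h ->]; apply/asboolP.
  by exists (a * g + h); rewrite mulrDl mulrA.
Qed.

HB.instance Definition _ n :=
  isIdealr.Build {poly int} (qpoch_ideal n) (qpoch_idealr_closed n).

Definition qpoch_idealr (n : nat) : idealr {poly int} := qpoch_ideal n.

Definition Zq (n : nat) : Type := {ideal_quot (qpoch_idealr n)}.
HB.instance Definition _ n := GRing.ComNzRing.on (Zq n).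

Definition cls (n : nat) (f : {poly int}) : Zq n :=
  \pi_({ideal_quot (qpoch_idealr n)}) f.

Lemma clsP n f g :
  cls n f = cls n g <-> exists h, f - g = h * qpoch n.+1.
Proof.
rewrite (rwP eqP) -[cls n f == _]Quotient.idealrBE.
by split=> [/asboolP|h]; last exact/asboolP.
Qed.

Lemma cls_is_zmod_morphism n : zmod_morphism (@cls n).
Proof. exact: rmorphB. Qed.

Lemma cls_is_monoid_morphism n : monoid_morphism (@cls n).
Proof. by split; [exact: rmorph1 | exact: rmorphM]. Qed.

HB.instance Definition _ n :=
  GRing.isZmodMorphism.Build {poly int} (Zq n) (@cls n)
    (@cls_is_zmod_morphism n).
HB.instance Definition _ n :=
  GRing.isMonoidMorphism.Build {poly int} (Zq n) (@cls n)
    (@cls_is_monoid_morphism n).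

Lemma cls_surj n (x : Zq n) : exists f, x = cls n f.
Proof.
by exists (repr (x : {ideal_quot (qpoch_idealr n)})); rewrite /cls reprK.
Qed.

(* The natural projection when k <= n, see projE; a junk value otherwise. *)
Definition proj (n k : nat) (x : Zq n) : Zq k :=
  cls k (repr (x : {ideal_quot (qpoch_idealr n)})).

Lemma projE n k f : (k <= n)%N -> proj k (cls n f) = cls k f.
Proof.
move=> le_kn; rewrite /proj; apply/clsP.
have /clsP[h ->] : cls n (repr (cls n f : {ideal_quot (qpoch_idealr n)}))
                   = cls n f by rewrite /cls reprK.
elim: n h le_kn {f} => [|n IHn] h; first by rewrite leqn0 => /eqP->; exists h.
rewrite leq_eqVlt => /predU1P[->|lt_kn]; first by exists h.
have [h' Eh'] := IHn (h * (1 - 'X^(n.+2))) lt_kn.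
by exists h'; rewrite -Eh' [in LHS]qpochSE mulrAC mulrA.
Qed.

Section ProductRing.

Definition Zq_prod : Type := forall n, Zq n.

HB.instance Definition _ := Choice.copy Zq_prod (forall n, Zq n).

Implicit Types x y z : Zq_prod.

Definition Zq_prod0 : Zq_prod := fun n => 0.
Definition Zq_prod1 : Zq_prod := fun n => 1.
Definition Zq_prodN x : Zq_prod := fun n => - x n.
Definition Zq_prodD x y : Zq_prod := fun n => x n + y n.
Definition Zq_prodM x y : Zq_prod := fun n => x n * y n.

Fact Zq_prodDA : associative Zq_prodD.
Proof. by move=> x y z; apply: functional_extensionality_dep => n; apply: addrA. Qed.
Fact Zq_prodDC : commutative Zq_prodD.
Proof. by move=> x y; apply: functional_extensionality_dep => n; apply: addrC. Qed.
Fact Zq_prod0D : left_id Zq_prod0 Zq_prodD.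
Proof. by move=> x; apply: functional_extensionality_dep => n; apply: add0r. Qed.
Fact Zq_prodND : left_inverse Zq_prod0 Zq_prodN Zq_prodD.
Proof. by move=> x; apply: functional_extensionality_dep => n; apply: addNr. Qed.

HB.instance Definition _ :=
  GRing.isZmodule.Build Zq_prod Zq_prodDA Zq_prodDC Zq_prod0D Zq_prodND.

Fact Zq_prodMA : associative Zq_prodM.
Proof. by move=> x y z; apply: functional_extensionality_dep => n; apply: mulrA. Qed.
Fact Zq_prodMC : commutative Zq_prodM.
Proof. by move=> x y; apply: functional_extensionality_dep => n; apply: mulrC. Qed.
Fact Zq_prod1M : left_id Zq_prod1 Zq_prodM.
Proof. by move=> x; apply: functional_extensionality_dep => n; apply: mul1r. Qed.
Fact Zq_prodMDl : left_distributive Zq_prodM +%R.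
Proof. by move=> x y z; apply: functional_extensionality_dep => n; apply: mulrDl. Qed.
Fact Zq_prod1_neq0 : Zq_prod1 != 0.
Proof. by apply/eqP => /(congr1 (@^~ 0%N))/eqP; rewrite oner_eq0. Qed.

HB.instance Definition _ := GRing.Zmodule_isComNzRing.Build Zq_prod
  Zq_prodMA Zq_prodMC Zq_prod1M Zq_prodMDl Zq_prod1_neq0.

End ProductRing.

Definition coherent (x : Zq_prod) : bool :=
  `[< forall k n, (k <= n)%N -> proj k (x n) = x k >].

Lemma projB n k : (k <= n)%N -> {morph @proj n k : x y / x - y}.
Proof.
move=> le_kn x y; have [[f ->] [g ->]] := (cls_surj x, cls_surj y).
by rewrite -rmorphB !projE // rmorphB.
Qed.

Lemma projM n k : (k <= n)%N -> {morph @proj n k : x y / x * y}.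
Proof.
move=> le_kn x y; have [[f ->] [g ->]] := (cls_surj x, cls_surj y).
by rewrite -rmorphM !projE // rmorphM.
Qed.

Lemma proj1 n k : (k <= n)%N -> @proj n k 1 = 1.
Proof. by move=> le_kn; rewrite -[1 in LHS](rmorph1 (cls n)) projE ?rmorph1. Qed.

Lemma coherent_subring_closed : subring_closed coherent.
Proof.
split.
- by apply/asboolP => k n /proj1.
- move=> x y /asboolP cx /asboolP cy; apply/asboolP => k n le_kn.
  by rewrite [LHS](projB le_kn) cx ?cy.
- move=> x y /asboolP cx /asboolP cy; apply/asboolP => k n le_kn.
  by rewrite [LHS](projM le_kn) cx ?cy.
Qed.

HB.instance Definition _ :=
  GRing.isSubringClosed.Build Zq_prod coherent coherent_subring_closed.

Record habiro : Type := Habiro {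
  hcomp : Zq_prod;
  _ : hcomp \in coherent
}.

HB.instance Definition _ := [isSub for hcomp].
HB.instance Definition _ := [Choice of habiro by <:].
HB.instance Definition _ := [SubChoice_isSubComNzRing of habiro by <:].

(* s is the map induced on the limit by phi: phi descends to each quotient
   Z[q]/((q)_{k+1}), and s acts on the k-th component by that quotient map. *)
Definition induced_by (phi : {poly int} -> {poly int})
    (s : habiro -> habiro) : Prop :=
  forall (x : habiro) (k : nat) (f : {poly int}),
    hcomp x k = cls k f -> hcomp (s x) k = cls k (phi f).

Lemma induced_by_uniq phi s t : induced_by phi s -> induced_by phi t -> s =1 t.
Proof.
move=> hs ht x; apply: val_inj; apply: functional_extensionality_dep => k.
by have [f /[dup] /hs + /ht] := cls_surj (hcomp x k) => /= -> ->.
Qed.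

(* Main.v *)
Require Import Defs.
From mathcomp Require Import all_boot all_order all_algebra.
From HB Require Import structures.
From mathcomp Require Import boolp.

(** The substitution q |-> q^n sends (q)_k to
    (1 - q^n)(1 - q^(2n)) ... (1 - q^(kn)), and 1 - q^i divides 1 - q^(in)
    (geometric sum), so (q)_k divides its image factor by factor
    ([qpoch_comp_Xn]).  Hence the substitution maps the ideal ((q)_k) into
    itself, descends to each quotient of Z[q] compatibly with the projections,
    and so induces a ring endomorphism of the limit; this holds for any ring
    endomorphism of Z[q] that preserves the ideals ([induced_rmorphism]).
    An induced map is determined by the map of Z[q] that induces it, so the
    semigroup laws follow from those of the substitutions:
    f(q^1) = f(q), and substituting q^n and then q^m amounts to substituting
    q^(mn). *)

Import GRing.Theory.
Local Open Scope ring_scope.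

Lemma hcompP (x : habiro) (k n : nat) :
  (k <= n)%N -> proj k (hcomp x n) = hcomp x k.
Proof. by move=> le_kn; have /asboolP/(_ k n le_kn) := valP x. Qed.

Section Induced.

Variable phi : {rmorphism {poly int} -> {poly int}}.
Hypothesis phi_qpoch :
  forall k, exists h, phi (qpoch k.+1) = h * qpoch k.+1.

(** [phi] descends to each quotient of Z[q]. *)
Lemma cls_phi k f g : cls k f = cls k g -> cls k (phi f) = cls k (phi g).
Proof.
move=> /clsP[h fgE]; have [h' phiE] := phi_qpoch k.
by apply/clsP; exists (phi h * h'); rewrite -rmorphB fgE rmorphM phiE mulrA.
Qed.

(** The components [cls k (phi (f k))], for any lifts [f k] of the components
    of [x], do not depend on the lifts and are coherent. *)
Lemma induced_exists (x : habiro) : exists y : habiro,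
  forall k f, hcomp x k = cls k f -> hcomp y k = cls k (phi f).
Proof.
have /choice[f fE] : forall k, exists f, hcomp x k = cls k f.
  by move=> k; apply: cls_surj.
have cy : (fun k => cls k (phi (f k)) : Zq k) \in coherent.
  apply/asboolP => k n le_kn; rewrite projE //; apply: cls_phi.
  by rewrite -fE -(hcompP x k n) // fE projE.
exists (Habiro cy) => k g xE /=.
by apply: cls_phi; rewrite -fE.
Qed.

Lemma induced_rmorphism :
  exists s : {rmorphism habiro -> habiro}, induced_by phi s.
Proof.
have /choice[s sE] := induced_exists.
have s_ext (y z : habiro) : (forall k, hcomp y k = hcomp z k) -> y = z.
  by move=> yz; apply: val_inj; apply: functional_extensionality_dep.
have sB : zmod_morphism s.
  move=> x y; apply: s_ext => k.
  have [[f xE] [g yE]] := (cls_surj (hcomp x k), cls_surj (hcomp y k)).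
  rewrite (sE _ k (f - g)); last by rewrite [RHS]rmorphB /= -xE -yE.
  by rewrite !rmorphB /= -(sE _ _ _ xE) -(sE _ _ _ yE).
have sM : monoid_morphism s.
  split=> [|x y]; apply: s_ext => k.
    by rewrite (sE _ k 1) ?rmorph1.
  have [[f xE] [g yE]] := (cls_surj (hcomp x k), cls_surj (hcomp y k)).
  rewrite (sE _ k (f * g)); last by rewrite [RHS]rmorphM /= -xE -yE.
  by rewrite !rmorphM /= -(sE _ _ _ xE) -(sE _ _ _ yE).
pose sZ := GRing.isZmodMorphism.Build _ _ s sB.
pose sR := GRing.isMonoidMorphism.Build _ _ s sM.
pose S : {rmorphism habiro -> habiro} := HB.pack s sZ sR.
by exists S => x k f; apply: sE.
Qed.

End Induced.

Lemma comp_poly_Xn_comp (R : comNzRingType) (f : {poly R}) (m n : nat) :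
  (f \Po 'X^n) \Po 'X^m = f \Po 'X^(m * n).
Proof. by rewrite -comp_polyA comp_Xn_poly exprM. Qed.

(** The cofactor is the product of the geometric sums
    (1 - q^(in)) / (1 - q^i).  For [n = 0] these sums are empty and the substitution
    is the evaluation at q = 1. *)
Lemma qpoch_comp_Xn (n k : nat) :
  exists h, qpoch k \Po 'X^n = h * qpoch k.
Proof.
exists (\prod_(1 <= i < k.+1) \sum_(j < n) ('X^i) ^+ j).
rewrite /qpoch rmorph_prod -big_split; apply: eq_bigr => i _ /=.
rewrite rmorphB rmorph1 /= comp_Xn_poly -exprM mulnC exprM.
by rewrite -[1 in LHS](expr1n _ n) subrXX mulrC; congr (_ * _);
  apply: eq_bigr => j _; rewrite expr1n mul1r.
Qed.

Local Close Scope ring_scope.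

Theorem proposition2p1 :
  exists sigma : nat -> {rmorphism habiro -> habiro},
    (forall n : nat, 0 < n ->
       induced_by (fun f : {poly int} => (f \Po 'X^n)%R) (sigma n)) /\
    (forall x : habiro, sigma 1 x = x) /\
    (forall m n : nat, 0 < m -> 0 < n ->
       forall x : habiro, sigma (m * n) x = sigma m (sigma n x)).
Proof.
have /choice[sigma sigmaE] : forall n : nat,
    exists s : {rmorphism habiro -> habiro},
      induced_by (fun f : {poly int} => (f \Po 'X^n)%R) s.
  by move=> n; apply: induced_rmorphism => k; apply: qpoch_comp_Xn.
exists sigma; split=> [n _ //|]; split=> [|m n _ _].
  apply: induced_by_uniq (sigmaE 1) _ => x k f xE.
  by rewrite expr1 comp_polyXr.
apply: induced_by_uniq (sigmaE (m * n)) _ => x k f xE.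
rewrite -comp_poly_Xn_comp.
exact/(sigmaE m)/(sigmaE n).
Qed.
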